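(* Every rooted tree can be reconstructed from its $U^r$-polynomial; that is, a rooted tree $(T,v)$ is determined up to rooted isomorphism by $U^r(T,v)$: if $(T,v)$ and $(T',v')$ are rooted trees with $U^r(T,v)=U^r(T',v')$, then there is a graph isomorphism $T\to T'$ mapping $v$ to $v'$.
   Context: All trees are finite. A rooted tree is a pair $(T,v)$ with $T$ a tree and $v$ a vertex of $T$ (the root). Let $z,x_1,x_2,\dots$ be commuting indeterminates. For a rooted tree $(T,v)$ with edge set $E$ and $A\subseteq E$, let $T|_A$ be the spanning subgraph of $T$ with edge set $A$ (all vertices kept), let $\lambda_r(A)$ be the number of vertices of the component of $T|_A$ containing $v$, and let $\lambda_-(A)$ be the partition whose parts are the numbers of vertices of the other components of $T|_A$. For a partition $\lambda=(\lambda_1,\dots,\lambda_s)$ put $\mathbf{x}_\lambda=x_{\lambda_1}\cdots x_{\lambda_s}$ (equal to $1$ for the empty partition). The rooted $U$-polynomial is $$U^r(T,v)=\sum_{A\subseteq E}\mathbf{x}_{\lambda_-(A)}\,z^{\lambda_r(A)}.$$ (For general rooted graphs each summand has the extra factor $(y-1)^{|A|-r(A)}$, with $r(A)$ the number of vertices minus the number of components of the spanning subgraph; for trees $r(A)=|A|$, so this factor is $1$.) *)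

(* Defs.v *)
From HB Require Import structures.
From mathcomp Require Import all_boot all_order all_algebra.
From mathcomp Require Import monalg.

Set Implicit Arguments.
Unset Strict Implicit.
Unset Printing Implicit Defensive.

Import GRing.Theory.
Local Open Scope ring_scope.

Record sgraph := SGraph {
  svertex :> finType;
  sedge : rel svertex;
  sedge_sym : symmetric sedge;
  sedge_irr : irreflexive sedge
}.

Definition edges (G : sgraph) : {set {set G}} :=
  [set [set p.1; p.2] | p : G * G & sedge p.1 p.2].

Definition connected (G : sgraph) : Prop :=
  forall x y : G, connect (@sedge G) x y.

(* [ucycle] also accepts the empty sequence and, in an irreflexive symmetric
   relation, [:: x; y] for every edge xy; graph cycles have length at least 3. *)
Definition acyclic (G : sgraph) : Prop :=
  forall c : seq G, ucycle (@sedge G) c -> (size c < 3)%N.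

Definition is_tree (G : sgraph) : Prop :=
  [/\ (0 < #|G|)%N, connected G & acyclic G].

Definition graph_iso (G H : sgraph) (f : G -> H) : Prop :=
  bijective f /\ {mono f : x y / sedge x y}.

Section RootedU.

Variable G : sgraph.
Implicit Types (A : {set {set G}}) (v x y : G).

(* Adjacency in G|_A, for A \subset edges G. *)
Definition span_rel A : rel G := [rel x y | [set x; y] \in A].

Definition component A x : {set G} := [set y | connect (span_rel A) x y].

Definition components A : {set {set G}} := [set component A x | x : G].

Definition lambda_r v A : nat := #|component A v|.

(* An integer partition is the weakly decreasing sequence of its parts. *)
Definition lambda_minus v A : seq nat :=
  sort geq [seq #|C : {set G}| | C <- enum (components A :\ component A v)].

End RootedU.

(* Z[z, x_1, x_2, ...]: the indeterminate with index None is z and the one with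
   index Some i is x_i. The extra indeterminate x_0 never occurs below, since
   components are nonempty. *)
Definition Upoly := {malg int[{cmonom option nat}]}.

Definition zvar : Upoly := << ucm None >>.
Definition xvar (i : nat) : Upoly := << ucm (Some i) >>.

Definition xpart (lam : seq nat) : Upoly := \prod_(i <- lam) xvar i.

(* For a general graph each term has a further factor (y - 1)^(|A| - r(A)),
   which is 1 when G is a forest; [Ur] is meant for trees only. *)
Definition Ur (G : sgraph) (v : G) : Upoly :=
  \sum_(A : {set {set G}} | A \subset edges G)
     xpart (lambda_minus v A) * zvar ^+ lambda_r v A.

(* Main.v *)
From HB Require Import structures.
Require Import Defs.
From mathcomp Require Import all_boot all_order all_algebra.
From mathcomp Require Import finmap monalg mpoly.

(** Cutting a rooted tree at the edges from its root v to the children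
    c_1, ..., c_k of v gives the rooted branches T_1, ..., T_k, and

      U^r(T, v) = z * \prod_i (U^r(T_i, c_i) + phi(U^r(T_i, c_i))),

    where phi is linear over the ring of the x_j and sends z^j to x_j: when the
    edge v c_i is kept, the component of c_i joins that of v, so the powers of
    z multiply; when it is deleted, that component, of size j say, becomes a
    part of lambda_-.

    If T_i has n vertices, every other edge set than A = E(T_i) leaves only
    components with fewer than n vertices, so x_n occurs in the i-th factor
    only as the term phi(z^n), and the factor is x_n + R, where R involves
    only z and the x_j with j < n.  Such factors are prime, since substituting
    -R for x_n maps into a domain and kills only their multiples, so the product
    determines the multiset of its factors ([planted_unique_factorization]).
    The terms of a factor that are divisible by z make up U^r(T_i, c_i), so
    U^r(T, v) determines the multiset of the polynomials of the branches
    ([branch_poly_children]).  Applying this at every vertex, starting from the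
    roots, one maps the children of each vertex to the children of its image
    bijectively and with the same branch polynomials; this is a rooted
    isomorphism ([matching]).

    A tree is handled through its parent function [pa : T -> option T] and a
    rank that decreases from a vertex to its parent; edge sets A become sets S
    of vertices that stay attached to their parents.  The recursion for U^r is
    proved in [branch_polyE_sum] without splitting S among the branches: the
    product over the whole tree is affine in the contribution of each vertex,
    so the sums U^r + phi(U^r) can be expanded one vertex at a time.
    The algebra takes place in K[z] with K = Z[x_0, ..., x_(N-1)] for N large,
    because phi needs the coefficients of the powers of z. *)

Set Implicit Arguments.
Unset Strict Implicit.
Unset Printing Implicit Defensive.

Import GRing.Theory.
Local Open Scope ring_scope.

(** * Rooted forests given by parent functions *)

Definition ranked (T : finType) (pa : T -> option T) (rk : T -> nat) :=
  forall x y, pa x = Some y -> (rk y < rk x)%N.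

Section Forest.

Variables (T : finType) (pa : T -> option T) (rk : T -> nat).
Hypothesis rkP : ranked pa rk.

Definition up : rel T := [rel x y | pa x == Some y].

Definition desc u : {set T} := [set w | connect up w u].

Lemma connect_upP x y :
  reflect (x = y \/ exists2 z, pa x = Some z & connect up z y) (connect up x y).
Proof.
apply: (iffP idP) => [/connectP[[|z p] /= xp ->]|[->|[z xz zy]]].
- by left.
- by case/andP: xp => /eqP xz zp; right; exists z => //; apply/connectP; exists p.
- exact: connect0.
by apply: connect_trans zy; apply: connect1; rewrite /up /= xz.
Qed.

Lemma connect_up_rank x y : connect up x y -> (rk y <= rk x)%N.
Proof.
case/connectP=> p; elim: p x => [x _ ->|z p IH x] //=.
by case/andP=> /eqP xz /IH{}IH /IH /leq_trans; apply; exact: ltnW (rkP xz).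
Qed.

(** Parents are unique, so the ancestors of [w] form a chain. *)
Lemma connect_up_linear w a b :
  connect up w a -> connect up w b -> connect up a b || connect up b a.
Proof.
case/connectP=> p; elim: p w => [w _ -> ->//|z p IH w] /=.
case/andP=> /eqP wz zp ap /connect_upP[wb|[z']].
  rewrite -wb orbC (_ : connect up w a) //; apply/connect_upP; right.
  by exists z => //; apply/connectP; exists p.
by rewrite wz => -[<-]; apply: IH.
Qed.

Lemma desc_self u : u \in desc u.
Proof. by rewrite inE connect0. Qed.

Lemma desc_child c u : pa c = Some u -> {subset desc c <= desc u}.
Proof.
move=> cu w; rewrite !inE => wc; apply: connect_trans wc _.
by apply: connect1; rewrite /up /= cu.
Qed.

Lemma notin_desc_child c u : pa c = Some u -> u \notin desc c.
Proof.
by move=> cu; rewrite inE; apply/negP => /connect_up_rank; rewrite leqNgt (rkP cu).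
Qed.

Lemma desc_child_inj u c c' w : pa c = Some u -> pa c' = Some u ->
  w \in desc c -> w \in desc c' -> c = c'.
Proof.
have main a b : pa a = Some u -> pa b = Some u -> connect up a b -> a = b.
  move=> au bu /connect_upP[//|[z]]; rewrite au => -[<-] ub.
  by have := notin_desc_child bu; rewrite inE ub.
move=> cu c'u; rewrite !inE => wc wc'.
by case/orP: (connect_up_linear wc wc') => /main -> //.
Qed.

Lemma desc_split u w : w \in desc u -> w != u ->
  exists2 c, pa c = Some u & w \in desc c.
Proof.
rewrite inE => /connectP[p]; elim: p w => [w _ ->|z p IH w] /=.
  by rewrite eqxx.
case/andP=> /eqP wz zp up_; have [zu _|zu _] := eqVneq z u.
  by exists w; rewrite ?desc_self // wz zu.
have [c cu zc] := IH _ zp up_ zu; exists c => //.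
by move: zc; rewrite !inE; apply: connect_trans; apply: connect1; rewrite /up /= wz.
Qed.

(** The descendants of the children of [u] partition the proper descendants of
    [u]; this carries sums and products through every recursion below. *)
Lemma big_desc_proper (R : Type) (idx : R) (op : Monoid.com_law idx) (F : T -> R) u :
  \big[op/idx]_(w in desc u | w != u) F w =
  \big[op/idx]_(c | pa c == Some u) \big[op/idx]_(w in desc c) F w.
Proof.
rewrite (exchange_big_dep (fun w => (w \in desc u) && (w != u))) /=.
  apply: eq_bigr => w /andP[wu w_u].
  have [c cu wc] := desc_split wu w_u.
  rewrite (big_pred1 c) // => c' /=; apply/andP/eqP => [[/eqP c'u wc']|->].
    exact: desc_child_inj c'u cu wc' wc.
  by rewrite cu.
move=> c w /eqP cu wc; rewrite (desc_child cu) //=.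
by apply: contraNneq (notin_desc_child cu) => <-.
Qed.

Lemma big_desc (R : Type) (idx : R) (op : Monoid.com_law idx) (F : T -> R) u :
  \big[op/idx]_(w in desc u) F w =
  op (F u) (\big[op/idx]_(c | pa c == Some u) \big[op/idx]_(w in desc c) F w).
Proof. by rewrite (bigD1 u) ?desc_self //= big_desc_proper. Qed.

Lemma card_desc u : #|desc u| = (1 + \sum_(c | pa c == Some u) #|desc c|)%N.
Proof.
rewrite -sum1_card big_desc /=; congr addn; apply: eq_bigr => c _.
by rewrite sum1_card.
Qed.

Definition rk_max : nat := \max_x rk x.

Lemma rk_child c u : pa c = Some u -> (rk_max - rk c < rk_max - rk u)%N.
Proof.
by move=> /rkP cu; rewrite ltn_sub2l // (leq_trans cu) // /rk_max leq_bigmax.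
Qed.

Lemma forest_ind (Pr : T -> Prop) :
  (forall u, (forall c, pa c = Some u -> Pr c) -> Pr u) -> forall u, Pr u.
Proof.
move=> step u; have [n] := ubnP (rk_max - rk u).
elim: n u => // n IH u; rewrite ltnS => un; apply: step => c cu.
by apply: IH; apply: leq_trans un; apply: rk_child.
Qed.

(** A common form for the recursion of the U-polynomial and of its single terms:
    [op c] tells how the branch at [c] contributes to that of its parent. *)
Section Branch.
Variable (L : comNzRingType) (z : L).
Implicit Type op : T -> L -> L.

(** Recursion from a vertex to its children is not structural; as the rank
    increases along it, [rk_max - rk u] bounds its depth below [u]. *)
Fixpoint branch_fuel op n u : L :=
  if n is n'.+1 then z * \prod_(c | pa c == Some u) op c (branch_fuel op n' c)
  else 1.

Definition branch op u := branch_fuel op (rk_max - rk u).+1 u.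

Lemma branchE op u :
  branch op u = z * \prod_(c | pa c == Some u) op c (branch op c).
Proof.
have stable n m w : (rk_max - rk w < n)%N -> (rk_max - rk w < m)%N ->
    branch_fuel op n w = branch_fuel op m w.
  elim: n m w => [|n IH] [|m] w //; rewrite !ltnS => wn wm /=.
  congr (_ * _); apply: eq_bigr => c /eqP /rk_child cw; congr (op c _).
  by apply: IH; apply: leq_trans cw _.
rewrite [LHS]/branch /=; congr (_ * _); apply: eq_bigr => c /eqP cu.
by congr (op c _); apply: stable => //; apply: rk_child.
Qed.

Lemma eq_branch op op' u :
  (forall c, c \in desc u -> c != u -> op c =1 op' c) ->
  branch op u = branch op' u.
Proof.
elim/forest_ind: u => u IH eq_op; rewrite !branchE; congr (_ * _).
apply: eq_bigr => c /eqP cu.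
have in_desc w : w \in desc c -> op w =1 op' w.
  move=> wc; apply: eq_op; first exact: desc_child cu _ wc.
  by apply: contraNneq (notin_desc_child cu) => <-.
by rewrite (IH c cu) ?in_desc ?desc_self // => w wc _; apply: in_desc.
Qed.

(** A proper descendant [w] of [u] lies below exactly one child of [u], so only
    one factor of the product depends on [op w], and [branch op u] is additive
    in it as long as every operator on the way up to [u] is additive. *)
Lemma branch_split op op1 op2 w u :
  w \in desc u -> w != u -> (forall x, {morph op x : a b / a + b}) ->
  (forall x, x != w -> op1 x =1 op x) -> (forall x, x != w -> op2 x =1 op x) ->
  (forall a, op w a = op1 w a + op2 w a) ->
  branch op u = branch op1 u + branch op2 u.
Proof.
move=> wu w_u opD off1 off2 opw; elim/forest_ind: u wu w_u => u IH wu w_u.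
have [c cu wc] := desc_split wu w_u.
have away op' c' : (forall x, x != w -> op' x =1 op x) ->
    (pa c' == Some u) && (c' != c) -> op' c' (branch op' c') = op c' (branch op c').
  move=> off /andP[/eqP c'u c'c].
  have wc' : w \notin desc c'.
    by apply: contraNN c'c => wc'; apply/eqP; apply: desc_child_inj c'u cu wc' wc.
  have in_desc y : y \in desc c' -> op' y =1 op y.
    by move=> yc'; apply: off; apply: contraNneq wc' => <-.
  by rewrite (eq_branch (op' := op)) ?in_desc ?desc_self // => y yc _; apply: in_desc.
rewrite !branchE !(bigD1 (P := fun c => pa c == Some u) c) ?cu //=.
rewrite (eq_bigr _ (away op1 ^~ off1)) (eq_bigr _ (away op2 ^~ off2)).
rewrite -mulrDr -mulrDl; congr (_ * (_ * _)).
have [wc_eq|w_c] := eqVneq c w.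
  have same op' : (forall x, x != w -> op' x =1 op x) -> branch op' w = branch op w.
    by move=> off; apply: eq_branch => y _; apply: off.
  by rewrite wc_eq (same op1) // (same op2).
by rewrite off1 // off2 // (IH c) // ?opD // eq_sym.
Qed.

End Branch.
End Forest.

(** * Expansion of the recursive product over sets of kept edges *)

Lemma sum_subset_pick (T : finType) (V : nmodType) (h : {set T} -> V) (X : {set T}) w :
  w \in X ->
  \sum_(S : {set T} | S \subset X) h S =
  \sum_(S : {set T} | S \subset X :\ w) (h (w |: S) + h S).
Proof.
move=> wX; rewrite big_split /= (bigID (fun S : {set T} => w \in S)) /=; congr (_ + _).
  rewrite (reindex_onto (fun S => w |: S) (fun S => S :\ w)) /=; last first.
    by move=> S /andP[_ wS]; rewrite setD1K.
  apply: eq_bigl => S; rewrite setU11 andbT subUset sub1set wX /= subsetD1.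
  congr (_ && _); apply/eqP/idP => [<-|wS]; rewrite ?setD11 ?setU1K //.
by apply: eq_bigl => S; rewrite subsetD1.
Qed.

Section Cut.

Variables (K : comNzRingType) (x : nat -> K).
Implicit Types P Q : {poly K}.

(** The map phi that turns the component of the root, counted by the power of
    the variable, into an ordinary component: 'X^k becomes [x k]. *)
Definition cut P : {poly K} := (\sum_(k < size P) P`_k * x k)%:P.

(** Contribution of a branch to its parent: either the edge is kept or it is
    deleted. *)
Definition attach P := P + cut P.

Lemma cutE n P : (size P <= n)%N -> cut P = (\sum_(k < n) P`_k * x k)%:P.
Proof.
move=> Pn; rewrite /cut (big_ord_widen n (fun k => P`_k * x k)) //.
rewrite [in RHS](bigID (fun k : 'I_n => (k < size P)%N)) /= [X in _ + X]big1 ?addr0 //.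
by move=> k; rewrite -leqNgt => kP; rewrite nth_default ?mul0r.
Qed.

Lemma cutD : {morph cut : P Q / P + Q}.
Proof.
move=> P Q; set n := maxn (size P) (size Q).
rewrite (@cutE n (P + Q)%R) ?size_polyD // (@cutE n P) ?leq_maxl // (@cutE n Q) ?leq_maxr //.
rewrite -polyCD -big_split /=; congr (_%:P).
by apply: eq_bigr => k _; rewrite coefD mulrDl.
Qed.

Lemma attachD : {morph attach : P Q / P + Q}.
Proof. by move=> P Q; rewrite /attach cutD addrACA. Qed.

Lemma cutCX c k : cut (c%:P * 'X^k) = (c * x k)%:P.
Proof.
have sz : (size (c%:P * 'X^k)%R <= k.+1)%N.
  by rewrite mul_polyC (leq_trans (size_scale_leq _ _)) // size_polyXn.
rewrite (cutE sz) big_ord_recr /= big1 ?add0r => [|i _]; rewrite coefCM coefXn.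
  by rewrite eqxx mulr1.
by rewrite ltn_eqF // mulr0 mul0r.
Qed.

End Cut.

Section Expansion.

Variables (T : finType) (pa : T -> option T) (rk : T -> nat).
Hypothesis rkP : ranked pa rk.
Variables (K : comNzRingType) (x : nat -> K).

Definition branch_poly : T -> {poly K} := branch pa rk 'X (fun=> attach x).

Lemma branch_polyE u :
  branch_poly u = 'X * \prod_(c | pa c == Some u) attach x (branch_poly c).
Proof. exact: branchE. Qed.

(** The forest left when only the vertices of [S] keep the edge to their parent;
    its trees are the components of the spanning subgraph. *)
Definition prune (S : {set T}) w := if w \in S then pa w else None.

(** State of the expansion: the edges above [X] are undecided, those above [S]
    are kept, and all others are deleted. *)
Definition pending (X S : {set T}) w : {poly K} -> {poly K} :=
  if w \in X then attach x else if w \in S then id else cut x.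

Lemma pendingD X S w : {morph pending X S w : P Q / P + Q}.
Proof.
by move=> P Q; rewrite /pending; case: ifP => _; [exact: attachD | case: ifP; rewrite ?cutD].
Qed.

Lemma branch_pending_sum u (X S : {set T}) :
  X \subset desc pa u :\ u -> [disjoint X & S] ->
  branch pa rk 'X (pending X S) u =
  \sum_(S' : {set T} | S' \subset X) branch pa rk 'X (pending set0 (S' :|: S)) u.
Proof.
have [n] := ubnP #|X|; elim: n X S => // n IH X S; rewrite ltnS => Xn Xu XS.
have [->|/set0Pn[w wX]] := eqVneq X set0.
  by rewrite (big_pred1 set0) ?set0U // => S'; rewrite subset0.
rewrite (sum_subset_pick _ wX) big_split /=.
have Xw : (#|X :\ w| < n)%N by move: Xn; rewrite (cardsD1 w X) wX.
have /setD1P[w_u wu] := subsetP Xu _ wX.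
have Xwu : X :\ w \subset desc pa u :\ u by rewrite (subset_trans _ Xu) ?subD1set.
have wS : w \notin S by rewrite (disjointFr XS wX).
have XwS : [disjoint X :\ w & S] by apply: disjointWl XS; rewrite subD1set.
have XwwS : [disjoint X :\ w & w |: S].
  rewrite disjoints_subset; apply/subsetP => y yX; rewrite !inE negb_or.
  by rewrite (disjointFr XwS yX) andbT; case/setD1P: yX.
rewrite (branch_split rkP (op1 := pending (X :\ w) (w |: S)) (op2 := pending (X :\ w) S) _ wu) //.
- rewrite (IH _ (w |: S)) // (IH _ S) //; congr (_ + _).
  by apply: eq_bigr => S' _; rewrite setUCA setUA.
- exact: pendingD.
- by move=> y yw P; rewrite /pending !inE (negbTE yw).
- by move=> y yw P; rewrite /pending !inE (negbTE yw).
by move=> P; rewrite /pending wX !inE eqxx (negbTE wS).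
Qed.

Lemma prune_rk S : ranked (prune S) rk.
Proof. by move=> a b; rewrite /prune; case: ifP => // _ /rkP. Qed.

(** Once every edge is decided the recursion multiplies monomials: a vertex
    outside [S] other than [u] closes its component and contributes one variable [x], and the
    component of [u] collects the exponent of 'X. *)
Lemma branch_settled S u :
  branch pa rk 'X (pending set0 S) u =
  (\prod_(w in desc pa u | w != u) if w \in S then 1 else x #|desc (prune S) w|)%:P
  * 'X^#|desc (prune S) u|.
Proof.
elim/(forest_ind rkP): u => u IH; rewrite (branchE rkP) (big_desc_proper rkP).
rewrite (card_desc (@prune_rk S)) exprS mulrCA; congr (_ * _).
have kept c : (prune S c == Some u) = (pa c == Some u) && (c \in S).
  by rewrite /prune; case: (c \in S); rewrite ?andbT ?andbF.
rewrite (eq_bigl _ _ kept).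
rewrite -prodrXr big_mkcondr rmorph_prod -big_split /=.
apply: eq_bigr => c /eqP cu; rewrite (IH c cu) /pending inE.
rewrite [in RHS](bigD1 c) ?desc_self //=.
by case: ifP => _; rewrite ?mul1r // cutCX mulr1 mulrC.
Qed.

(** The recursive product is the rooted U-polynomial of the branch at [u], with
    [x j] for x_j and 'X for z. *)
Lemma branch_polyE_sum u :
  branch_poly u = \sum_(S : {set T} | S \subset desc pa u :\ u)
    (\prod_(w in desc pa u | w != u) if w \in S then 1 else x #|desc (prune S) w|)%:P
    * 'X^#|desc (prune S) u|.
Proof.
rewrite /branch_poly (eq_branch rkP (op' := pending (desc pa u :\ u) set0) _).
  rewrite branch_pending_sum //; last by rewrite disjoint_sym -setI_eq0 set0I.
  by apply: eq_bigr => S _; rewrite setU0 branch_settled.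
by move=> c cu c_u P; rewrite /pending !inE c_u; move: cu; rewrite inE => ->.
Qed.

End Expansion.

(** * Unique factorization for polynomials x_n + R *)

Section Planted.

Variables (K : idomainType) (x : nat -> K).
Implicit Types (P Q : {poly K}) (n : nat) (c : K).

(** [c] involves no other indeterminates than the [x k] with [k < n], in the
    form in which it is used: substitutions that fix these also fix [c]. *)
Definition below n c := forall tau : {rmorphism K -> {poly K}},
  (forall k, (k < n)%N -> tau (x k) = (x k)%:P) -> tau c = c%:P.

Lemma below_leq m n c : (m <= n)%N -> below m c -> below n c.
Proof. by move=> mn cm tau fix_x; apply: cm => k km; apply: fix_x; apply: leq_trans mn. Qed.

Lemma below_x n k : (k < n)%N -> below n (x k).
Proof. by move=> kn tau; apply. Qed.

Lemma below0 n : below n 0. Proof. by move=> tau _; rewrite !rmorph0. Qed.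

Lemma below1 n : below n 1. Proof. by move=> tau _; rewrite !rmorph1. Qed.

Lemma belowD n c d : below n c -> below n d -> below n (c + d).
Proof. by move=> cn dn tau fix_x; rewrite !rmorphD cn ?dn. Qed.

Lemma belowM n c d : below n c -> below n d -> below n (c * d).
Proof. by move=> cn dn tau fix_x; rewrite !rmorphM cn ?dn. Qed.

Lemma below_sum n (I : Type) (r : seq I) (p : pred I) (F : I -> K) :
  (forall i, p i -> below n (F i)) -> below n (\sum_(i <- r | p i) F i).
Proof. by move=> Fn; elim/big_rec: _ => [|i c pi]; [exact: below0 | apply/belowD/Fn]. Qed.

(** A substitution in the coefficients may take values that involve 'X, and 'X
    itself is fixed. *)
Definition substitute (tau : {rmorphism K -> {poly K}}) P := (map_poly tau P).['X].

Lemma substitute_prod tau (s : seq {poly K}) :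
  substitute tau (\prod_(Q <- s) Q) = \prod_(Q <- s) substitute tau Q.
Proof. by rewrite /substitute rmorph_prod horner_prod. Qed.

Lemma substituteD tau P Q : substitute tau (P + Q) = substitute tau P + substitute tau Q.
Proof. by rewrite /substitute rmorphD hornerD. Qed.

Lemma substituteC tau c : substitute tau c%:P = tau c.
Proof. by rewrite /substitute map_polyC hornerC. Qed.

Lemma substitute_below n (tau : {rmorphism K -> {poly K}}) P :
  (forall k, (k < n)%N -> tau (x k) = (x k)%:P) ->
  (forall k, below n P`_k) -> substitute tau P = P.
Proof.
move=> fix_x Pn; rewrite /substitute -[RHS]comp_polyXr /comp_poly; congr (_.['X]).
by apply/polyP => k; rewrite !coef_map /= Pn.
Qed.

(** [Q] is [x n] plus a polynomial in 'X and the [x k] with [k < n].  The index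
    [n] is read off as the degree, with which it agrees for the branches of a
    tree. *)
Definition planted Q := forall k, below (size Q).-1 (Q - (x (size Q).-1)%:P)`_k.

(** Algebraic independence of [x n] from its predecessors: it can be replaced by
    any polynomial, even one that involves 'X. *)
Definition free_at n := forall r, exists2 tau : {rmorphism K -> {poly K}},
  tau (x n) = r & forall k, (k < n)%N -> tau (x k) = (x k)%:P.

Lemma planted_substitute (tau : {rmorphism K -> {poly K}}) Q : planted Q ->
  (forall k, (k < (size Q).-1)%N -> tau (x k) = (x k)%:P) ->
  substitute tau Q = Q - (x (size Q).-1)%:P + tau (x (size Q).-1).
Proof.
move=> plQ fix_x; rewrite -{1}[Q](subrK (x (size Q).-1)%:P) substituteD substituteC.
by rewrite (substitute_below fix_x plQ).
Qed.

(** The substitution [x n := 1 - R] maps [x n + R] to 1. *)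
Lemma planted_neq0 Q : planted Q -> free_at (size Q).-1 -> Q != 0.
Proof.
move=> plQ /(_ (1 - (Q - (x (size Q).-1)%:P)))[tau tau_x fix_x]; apply/eqP => Q0.
have := planted_substitute plQ fix_x; rewrite tau_x addrC subrK.
rewrite {1}Q0 -polyC0 substituteC rmorph0 => /eqP.
by rewrite eq_sym oner_eq0.
Qed.

(** The substitution [x n := - R] that kills [Q = x n + R] kills a factor [P] of
    the second product.  As [P] has no larger degree than [Q], it is either fixed
    by the substitution, hence not killed, or equal to [x n + R'] and mapped to
    [R' - R], so that [P = Q]. *)
Lemma planted_mem Q s s' : \prod_(P <- s) P = \prod_(P <- s') P ->
  Q \in s -> planted Q -> free_at (size Q).-1 ->
  (forall P, P \in s' -> [/\ planted P, free_at (size P).-1 & (size P <= size Q)%N]) ->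
  Q \in s'.
Proof.
move=> eq_prod Qs plQ /(_ (- (Q - (x (size Q).-1)%:P)))[tau tau_x fix_x] pls'.
have tauQ : substitute tau Q = 0 by rewrite planted_substitute // tau_x subrr.
have : \prod_(P <- s') substitute tau P == 0.
  by rewrite -substitute_prod -eq_prod substitute_prod (big_rem Q) //= tauQ mul0r.
rewrite prodf_seq_eq0 => /hasP[P Ps' /= /eqP tauP].
have [plP frP] := pls' P Ps'; rewrite leq_eqVlt => /orP[/eqP szPQ|ltPQ].
  move: tauP; rewrite planted_substitute // szPQ // tau_x.
  by rewrite opprB addrA subrK => /eqP; rewrite subr_eq0 => /eqP <-.
have fixP k : (k <= (size P).-1)%N -> tau (x k) = (x k)%:P.
  have sz0 : (0 < size P)%N by rewrite size_poly_gt0 planted_neq0.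
  move=> kP; apply: fix_x; rewrite -(ltn_add2r 1) !addn1 prednK; last exact: leq_ltn_trans ltPQ.
  by apply: leq_ltn_trans ltPQ; rewrite -(prednK sz0) ltnS.
move: tauP; rewrite planted_substitute // => [|k kP]; last by rewrite fixP // ltnW.
by rewrite fixP // subrK => P0; have := planted_neq0 plP frP; rewrite P0 eqxx.
Qed.

Lemma seq_max_size (s : seq {poly K}) : s != [::] ->
  exists2 Q, Q \in s & forall P, P \in s -> (size P <= size Q)%N.
Proof.
elim: s => // P s IH _; have [->|/IH[Q Qs maxQ]] := eqVneq s [::].
  by exists P => [|R]; rewrite inE // => /eqP->.
have [PQ|QP] := leqP (size P) (size Q).
  by exists Q => [|R]; rewrite inE ?Qs ?orbT // => /predU1P[->|/maxQ].
exists P => [|R]; rewrite inE ?eqxx // => /predU1P[->//|/maxQ RQ].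
exact: leq_trans RQ (ltnW QP).
Qed.

(** A factor of maximal degree of one product also occurs in the other, whichever
    side it is on; cancel it and repeat. *)
Lemma planted_unique_factorization s s' :
  (forall P, P \in s ++ s' -> planted P /\ free_at (size P).-1) ->
  \prod_(P <- s) P = \prod_(P <- s') P -> perm_eq s s'.
Proof.
have [n] := ubnP (size (s ++ s')); elim: n s s' => // n IH s s'; rewrite ltnS => sn pls.
move=> eq_prod; have [ss0|/seq_max_size[Q Qss maxQ]] := eqVneq (s ++ s') [::].
  by case: s s' ss0 {sn pls eq_prod} => // -[].
have [plQ frQ] := pls Q Qss.
have in_cat P : P \in s \/ P \in s' -> [/\ planted P, free_at (size P).-1 & (size P <= size Q)%N].
  move=> Pss; have {}Pss : P \in s ++ s' by rewrite mem_cat; case: Pss => ->; rewrite ?orbT.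
  by have [] := pls P Pss; split => //; apply: maxQ.
have [Qs Qs'] : Q \in s /\ Q \in s'.
  move: Qss; rewrite mem_cat => /orP[Qs|Qs']; split => //.
    by apply: (planted_mem eq_prod) => // P Ps'; apply: in_cat; right.
  by apply: (planted_mem (esym eq_prod)) => // P Ps; apply: in_cat; left.
rewrite (permPl (perm_to_rem Qs)) (permPr (perm_to_rem Qs')) perm_cons.
apply: IH => [|P|].
- move: sn; rewrite !size_cat !size_rem //; apply: leq_trans.
  have : (0 < size s)%N by case: (s) Qs.
  by case: (size s) => // m _; rewrite addSn ltnS leq_add2l leq_pred.
- by rewrite mem_cat => /orP[] /mem_rem Ps; apply: pls; rewrite mem_cat Ps ?orbT.
apply: (mulfI (planted_neq0 plQ frQ)).
by move: eq_prod; rewrite (big_rem Q Qs) (big_rem Q Qs').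
Qed.

End Planted.

(** * The branch polynomials of the children *)

Section AttachShape.

Variables (K : idomainType) (x : nat -> K).
Implicit Types (P Q : {poly K}) (n : nat).

(** Among the edge sets of a branch with [n] vertices only the full one has a
    component of size [n], and it contributes 'X^n. *)
Definition branch_shape n P :=
  [/\ P \is monic, size P = n.+1 & forall k, (k < n)%N -> below x n P`_k].

(** Applying [cut] to the leading term 'X^n creates the term [x n]; every other
    term stays free of it. *)
Lemma attach_shape n P : (0 < n)%N -> branch_shape n P ->
  [/\ attach x P \is monic, size (attach x P) = n.+1, planted x (attach x P)
    & forall k, below x n.+1 (attach x P)`_k].
Proof.
move=> n0 [monP szP Pn].
have top : P`_n = 1 by move/monicP: monP; rewrite /lead_coef szP.
have sz_cut : (size (cut x P) < size P)%N.
  by rewrite /cut (leq_ltn_trans (size_polyC_leq1 _)) // szP ltnS.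
have sz : size (attach x P) = n.+1 by rewrite size_polyDl.
have Pbelow k : below x n P`_k.
  have [/Pn//|] := ltnP k n; rewrite leq_eqVlt => /orP[/eqP<-|nk].
    by rewrite top; apply: below1.
  by rewrite nth_default ?szP //; apply: below0.
have plQ : planted x (attach x P).
  move=> k; rewrite sz /= /attach /cut szP big_ord_recr /= top mul1r polyCD.
  rewrite addrA addrK coefD coefC; apply: belowD => //; case: eqP => _; last exact: below0.
  by apply: below_sum => i _; apply: belowM => //; apply: below_x.
split=> // [|k]; first by rewrite monicE lead_coefDl.
rewrite -[attach x P](subrK (x n)%:P) coefD; apply: belowD.
  by apply: below_leq (leqnSn n) _; have := plQ k; rewrite sz.
by rewrite coefC; case: eqP => _; [apply: below_x | apply: below0].
Qed.

End AttachShape.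

Section BranchShape.

Variables (T : finType) (pa : T -> option T) (rk : T -> nat).
Hypothesis rkP : ranked pa rk.
Variables (K : idomainType) (x : nat -> K).

Lemma branch_poly_shape u : branch_shape x #|desc pa u| (branch_poly pa rk x u).
Proof.
have pos w : (0 < #|desc pa w|)%N by apply/card_gt0P; exists w; apply: desc_self.
elim/(forest_ind rkP): u => u IH; rewrite (branch_polyE rkP).
set Pr := \prod_(c | _) _.
have [monPr szPr Prn] : [/\ Pr \is monic,
    size Pr = (\sum_(c | pa c == Some u) #|desc pa c|).+1
    & forall k, below x #|desc pa u| Pr`_k].
  rewrite /Pr; elim/big_rec2: _ => [|c n P /eqP cu [monP szP Pn]].
    split; rewrite ?monic1 ?size_poly1 // => k.
    by rewrite coef1; case: eqP => _; [apply: below1 | apply: below0].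
  have [monA szA _ An] := attach_shape (pos c) (IH c cu).
  split; rewrite ?monicMl // ?size_monicM ?monic_neq0 // ?szA ?szP ?addSn ?addnS //.
  move=> k; rewrite coefM; apply: below_sum => i _; apply: belowM => //.
  apply: below_leq (An _); apply: proper_card.
  apply/properP; split; first exact/subsetP/(desc_child cu).
  by exists u; [apply: desc_self | apply: (notin_desc_child rkP cu)].
split; first by rewrite monicMl ?monicX.
  by rewrite mulrC size_mulX ?monic_neq0 // szPr (card_desc rkP).
move=> k _; rewrite coefXM; case: eqP => _ //; exact: below0.
Qed.

Lemma branch_poly_coef0 u : (branch_poly pa rk x u)`_0 = 0.
Proof. by rewrite (branch_polyE rkP) coefXM. Qed.

End BranchShape.

(** Unique factorization recovers the factors [attach x (branch_poly c)], and
    [attach] changes only the constant coefficient, which is 0 in a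
    [branch_poly]. *)
Lemma branch_poly_children (T T' : finType) (pa : T -> option T) (pa' : T' -> option T')
    (rk : T -> nat) (rk' : T' -> nat) (K : idomainType) (x : nat -> K) u u' :
  ranked pa rk -> ranked pa' rk' ->
  (forall n, (n <= #|T|)%N -> free_at x n) -> (forall n, (n <= #|T'|)%N -> free_at x n) ->
  branch_poly pa rk x u = branch_poly pa' rk' x u' ->
  perm_eq [seq branch_poly pa rk x c | c <- enum [pred c | pa c == Some u]]
          [seq branch_poly pa' rk' x c | c <- enum [pred c | pa' c == Some u']].
Proof.
move=> rkP rkP' frT frT' eq_branches.
have planted_child (S : finType) (p : S -> option S) (r : S -> nat) (c : S) :
    ranked p r -> (forall n, (n <= #|S|)%N -> free_at x n) ->
    planted x (attach x (branch_poly p r x c))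
    /\ free_at x (size (attach x (branch_poly p r x c))).-1.
  move=> rP fr; have pos : (0 < #|desc p c|)%N by apply/card_gt0P; exists c; apply: desc_self.
  have [_ sz pl _] := attach_shape pos (branch_poly_shape rP x c).
  by rewrite sz; split => //; apply: fr; apply: max_card.
have perm_attach :
    perm_eq [seq attach x (branch_poly pa rk x c) | c <- enum [pred c | pa c == Some u]]
            [seq attach x (branch_poly pa' rk' x c) | c <- enum [pred c | pa' c == Some u']].
  apply: (@planted_unique_factorization _ x).
    by move=> P; rewrite mem_cat => /orP[] /mapP[c _ ->]; apply: planted_child.
  rewrite !big_map !big_enum /=; apply: (mulfI (negbT (polyX_eq0 K))).
  by rewrite -(branch_polyE rkP) -(branch_polyE rkP').
pose strip (Q : {poly K}) : {poly K} := Q - (Q`_0)%:P.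
have stripK (P : {poly K}) : P`_0 = 0 -> strip (attach x P) = P.
  move=> P0; rewrite /strip /attach /cut coefD coefC /= P0 add0r addrK //.
have unstrip (S : finType) (p : S -> option S) (r : S -> nat) (s : seq S) :
    ranked p r -> [seq branch_poly p r x c | c <- s]
    = [seq strip Q | Q <- [seq attach x (branch_poly p r x c) | c <- s]].
  move=> rP; rewrite -map_comp; apply: eq_map => c.
  by apply/esym/stripK; apply: branch_poly_coef0.
by rewrite !unstrip //; apply: perm_map.
Qed.

(** * Matching two forests from the roots down *)

Section Matching.

Variables (E : eqType) (T T' : finType).
Variables (pa : T -> option T) (pa' : T' -> option T') (rk : T -> nat).
Variables (code : T -> E) (code' : T' -> E) (v' : T').
Hypothesis rkP : ranked pa rk.

Definition twins y e := [seq c <- enum [pred c | pa c == Some y] | code c == e].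
Definition twins' y' e := [seq c <- enum [pred c | pa' c == Some y'] | code' c == e].

(** The children of [y] with a given code are sent, in the order of enumeration,
    to the children of [y'] with the same code.  The default [v'] is not reached
    when both lists have the same length. *)
Definition match_child y y' c := nth v' (twins' y' (code c)) (index c (twins y (code c))).

(** The image of [x] depends on that of its parent, so the recursion goes up to
    the root; [rk x] steps reach it. *)
Fixpoint matching_fuel n x :=
  match pa x, n with
  | Some y, n'.+1 => match_child y (matching_fuel n' y) x
  | _, _ => v'
  end.

Definition matching x := matching_fuel (rk x) x.

Lemma matching_root x : pa x = None -> matching x = v'.
Proof. by rewrite /matching; case: (rk x) => [|n] /= ->. Qed.

Lemma matching_child x y : pa x = Some y -> matching x = match_child y (matching y) x.
Proof.
have stable n m w : (rk w <= n)%N -> (rk w <= m)%N ->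
    matching_fuel n w = matching_fuel m w.
  elim: n m w => [|n IH] [|m] w //=; case Ew: (pa w) => [z|//] wn wm;
    have := rkP Ew => zw; try by case: (rk w) zw wn wm.
  by rewrite (IH m) // -ltnS (leq_trans zw).
move=> xy; rewrite /matching; have := rkP xy; case: (rk x) => // m ym /=.
by rewrite xy (stable m (rk y)).
Qed.

Hypothesis children_match : forall y y', code y = code' y' ->
  perm_eq [seq code c | c <- enum [pred c | pa c == Some y]]
          [seq code' c | c <- enum [pred c | pa' c == Some y']].

Lemma size_twins y y' e : code y = code' y' -> size (twins' y' e) = size (twins y e).
Proof.
by move=> /children_match /permP/(_ (pred1 e)); rewrite !count_map !size_filter.
Qed.

Lemma mem_twins y e c : (c \in twins y e) = (pa c == Some y) && (code c == e).
Proof. by rewrite mem_filter mem_enum inE andbC. Qed.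

Lemma mem_twins' y' e c : (c \in twins' y' e) = (pa' c == Some y') && (code' c == e).
Proof. by rewrite mem_filter mem_enum inE andbC. Qed.

Hypothesis rootP : forall x y, pa x = None -> pa y = None -> x = y.
Hypothesis rootP' : pa' v' = None.
Hypothesis code_root : forall x, pa x = None -> code x = code' v'.

Lemma match_childP y y' c : code y = code' y' -> pa c = Some y ->
  match_child y y' c \in twins' y' (code c).
Proof.
move=> yy' cy; rewrite /match_child mem_nth // (size_twins _ yy') index_mem.
by rewrite mem_twins cy !eqxx.
Qed.

Lemma match_child_inj y y' c d : code y = code' y' -> pa c = Some y -> pa d = Some y ->
  match_child y y' c = match_child y y' d -> c = d.
Proof.
move=> yy' cy dy eq_cd.
have cd : code c = code d.
  have := match_childP yy' cy; rewrite eq_cd mem_twins' => /andP[_ /eqP <-].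
  by have := match_childP yy' dy; rewrite mem_twins' => /andP[_ /eqP].
have tc : c \in twins y (code d) by rewrite mem_twins cy cd !eqxx.
have td : d \in twins y (code d) by rewrite mem_twins dy !eqxx.
move/eqP: eq_cd; rewrite /match_child cd nth_uniq ?(filter_uniq _ (enum_uniq _)) ?(size_twins _ yy') ?index_mem //.
by move/eqP/(congr1 (nth c (twins y (code d)))); rewrite !nth_index.
Qed.

(** Codes are preserved along with parents, so that [children_match] applies at
    every vertex and its image. *)
Lemma matchingP x : code x = code' (matching x) /\
  pa' (matching x) = omap matching (pa x).
Proof.
have [n] := ubnP (rk x); elim: n x => // n IH x; rewrite ltnS => xn.
case xy: (pa x) => [y|] /=; last by rewrite matching_root // rootP' code_root.
have [yc _] := IH y (leq_trans (rkP xy) xn).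
have := match_childP yc xy; rewrite -matching_child // mem_twins'.
by case/andP=> /eqP-> /eqP->.
Qed.

(** Equal images have equal parents, which by induction come from the same
    vertex; its children have distinct images. *)
Lemma matching_inj : injective matching.
Proof.
move=> x z; have [n] := ubnP (rk x); elim: n x z => // n IH x z; rewrite ltnS => xn xz.
have [_ pax] := matchingP x; have [_ paz] := matchingP z.
move: pax; rewrite xz paz; case xy: (pa x) => [y|]; case zw: (pa z) => [w|] //=.
  case=> wy; have {wy} wy : y = w by apply: IH (esym wy); apply: leq_trans xn; apply: rkP.
  rewrite -wy in zw; move: xz; rewrite (matching_child xy) (matching_child zw).
  by apply: match_child_inj => //; case: (matchingP y).
by move=> _; apply: rootP.
Qed.

End Matching.

(** * The parent function of a rooted tree *)

Section TreeParent.

Variables (G : sgraph) (v : G).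
Hypothesis treeG : is_tree G.
Implicit Types x y : G.

Definition walk_of_size x n := [exists t : n.-tuple G, path (@sedge G) x t && (last x t == v)].

Lemma walk_exists x : exists n, walk_of_size x n.
Proof.
have [_ conn _] := treeG; have /connectP[p xp pv] := conn x v.
by exists (size p); apply/existsP; exists (in_tuple p); rewrite xp pv eqxx.
Qed.

Definition dist x := ex_minn (walk_exists x).

(** Another connection from [x] to [y], shortened to a simple path, would close
    up with the edge [xy] to a cycle of length at least 3. *)
Lemma edge_acyclic_cut x y :
  sedge x y -> ~~ connect [rel a b : G | sedge a b && ([set a; b] != [set x; y])] x y.
Proof.
have [_ _ acyc] := treeG => xy; apply/negP => /connectP[p0 /shortenP[p xp Up _] py].
have sub : subrel [rel a b : G | sedge a b && ([set a; b] != [set x; y])] (@sedge G).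
  by move=> a b /andP[].
have /acyc : ucycle (@sedge G) (x :: p).
  rewrite /ucycle /cycle rcons_path (sub_path sub xp) -py sedge_sym xy /=.
  exact: Up.
case: p xp {Up} py => [_ yx|a [|//]] /=; first by rewrite yx sedge_irr in xy.
by rewrite andbT => /andP[_ neq] ya; rewrite -ya eqxx in neq.
Qed.

Definition parent x := [pick y | sedge x y && (dist y < dist x)%N].

Lemma parent_rank x y : parent x = Some y -> (dist y < dist x)%N.
Proof. by rewrite /parent; case: pickP => // z /andP[_ zx] [<-]. Qed.

Lemma parent_edge x y : parent x = Some y -> sedge x y.
Proof. by rewrite /parent; case: pickP => // z /andP[xz _] [<-]. Qed.

(** The second vertex of a shortest walk from [x] to [v] is closer to [v]. *)
Lemma parent_root x : parent x = None <-> x = v.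
Proof.
rewrite /parent; split=> [|->]; last first.
  case: pickP => // y /andP[_]; rewrite {2}/dist; case: ex_minnP => m _ /(_ 0%N).
  by rewrite leqn0 => /(_ _)/eqP-> //; apply/existsP; exists [tuple]; rewrite /= eqxx.
case: pickP => // noparent _.
case Em: (dist x) => [|m]; move: (Em); rewrite /dist; case: ex_minnP => n.
  case/existsP=> t /andP[_ /eqP tv] _ n0; rewrite n0 in t tv.
  by rewrite -tv [t]tuple0.
case/existsP=> t /andP[xt tv] _ nm; rewrite nm in t xt tv.
case/tupleP: t xt tv => y t /= /andP[xy yt] tv.
have := noparent y; rewrite xy Em ltnS /=.
rewrite {1}/dist; case: ex_minnP => k _ /(_ m) -> //.
by apply/existsP; exists t; rewrite yt.
Qed.

(** Both ends of an edge [xy] reach [v] through their ancestors; if no parent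
    edge were [xy], these two walks would connect [x] to [y] without it. *)
Lemma edge_parentE x y : sedge x y = (parent x == Some y) || (parent y == Some x).
Proof.
apply/idP/orP => [xy|[/eqP/parent_edge//|/eqP/parent_edge]]; last by rewrite sedge_sym.
apply/orP; apply: contraT; rewrite negb_or => /andP[npx npy].
pose e' := [rel a b : G | sedge a b && ([set a; b] != [set x; y])].
have e'_sym : connect_sym e'.
  by apply: sym_connect_sym => a b; rewrite /= sedge_sym setUC.
have to_root a : connect e' a v.
  have [n] := ubnP (dist a); elim: n a => // n IH a; rewrite ltnS => an.
  case pa: (parent a) => [b|]; last by rewrite ((parent_root a).1 pa) connect0.
  apply: connect_trans (IH b (leq_trans (parent_rank pa) an)); apply: connect1.
  rewrite /= (parent_edge pa) /=; apply: contraTneq (parent_edge pa) => eq_ab.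
  have : a \in [set x; y] by rewrite -eq_ab !inE eqxx.
  have bxy : b \in [set x; y] by rewrite -eq_ab !inE eqxx orbT.
  rewrite !inE => /orP[]/eqP ax; move: bxy; rewrite !inE ax => /orP[]/eqP bx; rewrite bx ?sedge_irr //.
    by rewrite -bx -ax pa eqxx in npx.
  by rewrite -bx -ax pa eqxx in npy.
have := edge_acyclic_cut xy; rewrite (connect_trans (to_root x)) //.
by rewrite e'_sym to_root.
Qed.

Lemma tree_is_forest : exists (pa : G -> option G) (rk : G -> nat),
  [/\ ranked pa rk,
      forall x, pa x = None <-> x = v
    & forall x y, sedge x y = (pa x == Some y) || (pa y == Some x)].
Proof.
exists parent, dist; split; [exact: parent_rank | exact: parent_root | exact: edge_parentE].
Qed.

End TreeParent.

(** * The rooted U-polynomial of a forest *)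

(** From a vertex below the root [r], a step to its parent stays below [r], as
    does a step to a child. *)
Lemma connect_root_sym (T : finType) (pa : T -> option T) r y : pa r = None ->
  connect [rel a b | up pa a b || up pa b a] r y = connect (up pa) y r.
Proof.
move=> r0; apply/idP/idP => [/connectP[p rp ->]|yr].
  suff reach a : path [rel a b | up pa a b || up pa b a] a p -> connect (up pa) a r ->
      connect (up pa) (last a p) r by exact: reach rp (connect0 _ _).
  elim: p a {rp} => [//|b p IH] a /= /andP[ab bp] ar; apply: IH bp _.
  case/orP: ab => [/eqP ab|ba]; last exact: connect_trans (connect1 ba) ar.
  case/connect_upP: ar => [ar|[z]]; first by rewrite -ar ab in r0.
  by rewrite ab => -[<-].
rewrite sym_connect_sym => [|a b]; last by rewrite /= orbC.
by apply: connect_sub yr => a b ab; apply: connect1; rewrite /= ab.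
Qed.

Lemma connect_up_root (T : finType) (pa : T -> option T) (rk : T -> nat) x :
  ranked pa rk -> exists2 r, pa r = None & connect (up pa) x r.
Proof.
move=> rkP; have [n] := ubnP (rk x); elim: n x => // n IH x; rewrite ltnS => xn.
case xy: (pa x) => [y|]; last by exists x.
have [r r0 yr] := IH y (leq_trans (rkP _ _ xy) xn); exists r => //.
by apply/connect_upP; right; exists y.
Qed.

Section RootedUForest.

Variables (G : sgraph) (v : G) (pa : G -> option G) (rk : G -> nat).
Hypothesis rkP : ranked pa rk.
Hypothesis pa_root : forall x, pa x = None <-> x = v.
Hypothesis pa_edge : forall x y, sedge x y = (pa x == Some y) || (pa y == Some x).
Implicit Types (x y : G) (S : {set G}).

Definition parent_pair x : {set G} := x |: [set y | pa x == Some y].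

Lemma parent_pairE x y : pa x = Some y -> parent_pair x = [set x; y].
Proof. by move=> xy; apply/setP => z; rewrite !inE xy (inj_eq Some_inj) (eq_sym y). Qed.

Lemma nonroot_parent x : x != v -> exists y, pa x = Some y.
Proof. by case E: (pa x) => [y|] xv; [exists y | rewrite ((pa_root x).1 E) eqxx in xv]. Qed.

Lemma parent_pair_inj S : v \notin S -> {in S &, injective parent_pair}.
Proof.
move=> vS a b aS bS; have nv x : x \in S -> x != v by apply: contraTneq => ->.
have [a' aa'] := nonroot_parent (nv a aS); have [b' bb'] := nonroot_parent (nv b bS).
rewrite (parent_pairE aa') (parent_pairE bb') => eq_ab.
have : a \in [set b; b'] by rewrite -eq_ab !inE eqxx.
have : b \in [set a; a'] by rewrite eq_ab !inE eqxx.
rewrite !inE => /orP[/eqP->//|/eqP ba'] /orP[/eqP->//|/eqP ab'].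
by have := rkP aa'; rewrite -ba' ltnNge ltnW //; apply: rkP; rewrite bb' -ab'.
Qed.

Lemma edges_parent_pair : edges G = [set parent_pair x | x in ~: [set v]].
Proof.
apply/setP => e; apply/imsetP/imsetP => [[[a b] /= ab ->]|[x]].
  move: ab; rewrite inE /= pa_edge => /orP[] /eqP ab.
    exists a; last by rewrite (parent_pairE ab).
    by rewrite !inE; apply/eqP => av; rewrite ((pa_root a).2 av) in ab.
  exists b; last by rewrite (parent_pairE ab) setUC.
  by rewrite !inE; apply/eqP => av; rewrite ((pa_root b).2 av) in ab.
rewrite !inE => /nonroot_parent[y xy] ->; exists (x, y); last exact: parent_pairE.
by rewrite inE /= pa_edge xy eqxx.
Qed.

Lemma prune_up S x y : up (prune pa S) x y = (x \in S) && (pa x == Some y).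
Proof. by rewrite /up /prune /=; case: (x \in S). Qed.

Lemma span_rel_prune S : v \notin S ->
  span_rel (parent_pair @: S) =2 [rel a b | up (prune pa S) a b || up (prune pa S) b a].
Proof.
move=> vS a b; rewrite [RHS]/= !prune_up; apply/imsetP/orP => [[x xS]|].
  have /nonroot_parent[y xy] : x != v by apply: contraTneq xS => ->.
  rewrite (parent_pairE xy) => eq_ab.
  have xab : x \in [set a; b] by rewrite eq_ab !inE eqxx.
  have yab : y \in [set a; b] by rewrite eq_ab !inE eqxx orbT.
  have yx : y <> x by move=> yx; have := rkP xy; rewrite yx ltnn.
  move: xab yab; rewrite !inE => /orP[]/eqP xa /orP[]/eqP yb.
  - by rewrite yb xa in yx.
  - by left; rewrite -xa -yb xS xy eqxx.
  - by right; rewrite -xa -yb xS xy eqxx.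
  - by rewrite yb xa in yx.
by case=> /andP[xS /eqP xy]; [exists a | exists b] => //; rewrite (parent_pairE xy) 1?setUC.
Qed.

Lemma component_prune S r : v \notin S -> prune pa S r = None ->
  component (parent_pair @: S) r = desc (prune pa S) r.
Proof.
move=> vS r0; apply/setP => y; rewrite !inE -(connect_root_sym _ r0).
by apply: eq_connect; apply: span_rel_prune.
Qed.

Lemma prune_root S x : v \notin S -> (prune pa S x == None) = (x \notin S).
Proof.
rewrite /prune; case: ifP => // xS vS; apply/negbTE.
by apply: contraNN vS => /eqP/pa_root <-.
Qed.

Lemma desc_root_inj (p : G -> option G) r r' :
  p r = None -> p r' = None -> desc p r = desc p r' -> r = r'.
Proof.
move=> r0 r0' eq_rr'; have : r \in desc p r' by rewrite -eq_rr' desc_self.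
by rewrite inE => /connect_upP[//|[z]]; rewrite r0.
Qed.

(** Every vertex is joined to the root of its tree in the pruned forest, so its
    component is the one of that root. *)
Lemma components_prune S : v \notin S ->
  components (parent_pair @: S) = [set desc (prune pa S) r | r in ~: S].
Proof.
move=> vS; have root r : r \in ~: S -> prune pa S r = None.
  by rewrite inE -prune_root // => /eqP.
apply/setP => C; apply/imsetP/imsetP => [[x _ ->]|[r rS ->]]; last first.
  by exists r => //; rewrite component_prune ?root.
have [r r0 xr] := connect_up_root x (@prune_rk _ _ _ rkP S).
exists r; first by rewrite inE -prune_root ?r0.
rewrite -component_prune //; apply/setP => y; rewrite !inE.
apply: same_connect; first by apply: sym_connect_sym => a b; rewrite /span_rel /= setUC.
rewrite (eq_connect (span_rel_prune vS)) sym_connect_sym; last by move=> a b; rewrite /= orbC.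
by rewrite connect_root_sym.
Qed.

Lemma xpart_prune S : v \notin S ->
  xpart (lambda_minus v (parent_pair @: S)) =
  \prod_(w | (w \notin S) && (w != v)) xvar #|desc (prune pa S) w|.
Proof.
move=> vS; have root r : r \notin S -> prune pa S r = None by rewrite -prune_root // => /eqP.
rewrite /xpart (perm_big _ (permEl (perm_sort _ _))) /= big_map big_enum /=.
rewrite components_prune // component_prune ?root //.
have -> : [set desc (prune pa S) r | r in ~: S] :\ desc (prune pa S) v =
    [set desc (prune pa S) r | r in ~: S :\ v].
  apply/setP => C; rewrite !inE; apply/andP/imsetP => [[Cv /imsetP[r rS Cr]]|[r]].
    by exists r => //; rewrite !inE in rS *; rewrite rS andbT; apply: contraNneq Cv => <-; apply/eqP.
  rewrite !inE => /andP[rv rS] ->; split; last by apply: imset_f; rewrite inE.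
  by apply: contraNneq rv => /desc_root_inj-> //; apply: root.
rewrite big_imset /=; last first.
  move=> a b; rewrite !inE => /andP[_ aS] /andP[_ bS].
  by apply: desc_root_inj; apply: root.
by apply: eq_bigl => w; rewrite !inE andbC.
Qed.

(** A set of edges is determined by the lower end points of its edges, and any
    set of non-root vertices can occur. *)
Lemma UrE : Ur v = \sum_(S : {set G} | v \notin S)
  (\prod_(w | (w \notin S) && (w != v)) xvar #|desc (prune pa S) w|)
  * zvar ^+ #|desc (prune pa S) v|.
Proof.
rewrite /Ur (reindex_onto (fun S : {set G} => parent_pair @: S)
   (fun A => [set x | (x != v) && (parent_pair x \in A)])) /=; last first.
  move=> A; rewrite edges_parent_pair => /subsetP sA; apply/setP => e.
  apply/imsetP/idP => [[x]|eA]; first by rewrite inE => /andP[_ xA] ->.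
  have /imsetP[x xv ex] := sA _ eA; exists x => //.
  by move: xv; rewrite !inE => ->; rewrite -ex.
apply: eq_big => [S|S].
  apply/andP/idP => [[_ /eqP <-]|vS]; first by rewrite inE eqxx.
  split; first by rewrite edges_parent_pair imsetS // subsetC sub1set inE.
  apply/eqP/setP => x; rewrite inE; apply/andP/idP => [[xv /imsetP[y yS eq_xy]]|xS].
    rewrite (@parent_pair_inj (~: [set v]) _ x y) ?inE ?eqxx //.
    by apply: contraTneq yS => ->.
  by split; [apply: contraTneq xS => -> | apply: imset_f].
move=> /andP[_ /eqP eqS]; have vS : v \notin S by rewrite -eqS inE eqxx.
have v0 : prune pa S v = None by apply/eqP; rewrite prune_root.
by rewrite (xpart_prune vS) /lambda_r (component_prune vS v0).
Qed.

End RootedUForest.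

(** * Evaluation in a domain and reconstruction *)

Section MonomialEvaluation.

Variables (I : choiceType) (L : comNzRingType) (a : I -> L).

(** The monomials are free on [I], so a valuation of the indeterminates extends
    to a ring morphism [malg_eval]. *)
Definition cmonom_eval (m : {cmonom I}) : L := \prod_(i <- finsupp m) a i ^+ m i.

Lemma cmonom_evalE (d : {fset I}) (m : {cmonom I}) : (finsupp m `<=` d)%fset ->
  cmonom_eval m = \prod_(i <- d) a i ^+ m i.
Proof.
move=> md; rewrite /cmonom_eval (big_fset_incl _ md) // => i _.
by rewrite -cmE_eq0 => /eqP->.
Qed.

Lemma cmonom_eval_mmorphism : mmorphism cmonom_eval.
Proof.
split=> [m1 m2|]; last by rewrite /cmonom_eval mdom1 big_seq_fset0.
rewrite {1}/cmonom_eval mdomD (cmonom_evalE (fsubsetUl _ (finsupp m2))).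
rewrite (cmonom_evalE (fsubsetUr (finsupp m1) _)) -big_split /=.
by apply: eq_bigr => i _; rewrite cmM exprD.
Qed.

HB.instance Definition _ :=
  monalg.isMultiplicative.Build _ _ cmonom_eval cmonom_eval_mmorphism.

Lemma cmonom_eval_ucm i : cmonom_eval (ucm i) = a i.
Proof. by rewrite /cmonom_eval mdomU big_seq_fset1 cmUU. Qed.

Definition malg_eval : {malg int[{cmonom I}]} -> L := monalg.mmap intr cmonom_eval.
HB.instance Definition _ := GRing.RMorphism.on malg_eval.

End MonomialEvaluation.

Section GenericVariables.

Variable N : nat.

(** Finitely many independent variables suffice for a given pair of trees; the
    value 0 beyond [N] only makes the family total. *)
Definition generic_var k : mpoly N int := if insub k is Some i then 'X_i else 0.

Lemma generic_var_free n : (n < N)%N -> free_at generic_var n.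
Proof.
move=> nN r.
pose h (i : 'I_N) : {poly mpoly N int} := if i == n :> nat then r else ('X_i)%:P.
exists (mmap intr h : {rmorphism _ -> _}) => [|k kn].
  by rewrite /generic_var insubT /= mmapX mmap1U /h /= eqxx.
by rewrite /generic_var (insubT (fun i => (i < N)%N) (ltn_trans kn nN)) /= mmapX mmap1U /h /= ltn_eqF.
Qed.

(** The root has every vertex of the tree as a descendant, so its branch is the
    whole tree. *)
Lemma malg_eval_Ur (G : sgraph) (v : G) (pa : G -> option G) (rk : G -> nat) :
  ranked pa rk ->
  (forall x, pa x = None <-> x = v) ->
  (forall x y, sedge x y = (pa x == Some y) || (pa y == Some x)) ->
  malg_eval (oapp (fun k => (generic_var k)%:P) 'X) (Ur v)
  = branch_poly pa rk generic_var v.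
Proof.
move=> rkP pa_root pa_edge; rewrite (UrE rkP pa_root pa_edge) (branch_polyE_sum rkP).
have descT w : w \in desc pa v.
  by have [r /pa_root -> wv] := connect_up_root w rkP; rewrite inE.
rewrite rmorph_sum /=; apply: eq_big => [S|S _].
  by rewrite subsetD1 (_ : S \subset _) //; apply/subsetP => w _.
rewrite rmorphM rmorph_prod rmorphXn /= {2}/malg_eval /zvar monalg.mmapU cmonom_eval_ucm mul1r.
congr (_ * _); rewrite rmorph_prod /=.
rewrite (eq_bigl (fun w => (w != v) && (w \notin S))) => [|w]; last by rewrite andbC.
rewrite big_mkcondr [in RHS](eq_bigl (fun w => w != v)) => [|w]; last by rewrite descT.
apply: eq_bigr => w _; rewrite fun_if; case: (w \in S) => //=.
by rewrite /malg_eval /xvar monalg.mmapU cmonom_eval_ucm mul1r.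
Qed.

End GenericVariables.

Theorem theorem9 (T T' : sgraph) (v : T) (v' : T')
    (treeT : is_tree T) (treeT' : is_tree T') :
  Ur v = Ur v' -> exists f : T -> T', graph_iso f /\ f v = v'.
Proof.
move=> eqU; pose N := (maxn #|T| #|T'|).+1.
have [pa [rk [rkP rootP edgeP]]] := tree_is_forest v treeT.
have [pa' [rk' [rkP' rootP' edgeP']]] := tree_is_forest v' treeT'.
pose code := branch_poly pa rk (@generic_var N).
pose code' := branch_poly pa' rk' (@generic_var N).
have eq_code : code v = code' v'.
  by rewrite /code -(malg_eval_Ur N rkP rootP edgeP) eqU (malg_eval_Ur N rkP' rootP' edgeP').
have freeT n : (n <= #|T|)%N -> free_at (@generic_var N) n.
  by move=> nT; apply: generic_var_free; rewrite ltnS leq_max nT.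
have freeT' n : (n <= #|T'|)%N -> free_at (@generic_var N) n.
  by move=> nT; apply: generic_var_free; rewrite ltnS leq_max nT orbT.
have children y y' := branch_poly_children (u := y) (u' := y') rkP rkP' freeT freeT'.
have children' y y' := branch_poly_children (u := y) (u' := y') rkP' rkP freeT' freeT.
have rootI x y : pa x = None -> pa y = None -> x = y.
  by move=> /rootP -> /rootP ->.
have rootI' x y : pa' x = None -> pa' y = None -> x = y.
  by move=> /rootP' -> /rootP' ->.
pose f := matching pa pa' rk code code' v'.
have code_root x : pa x = None -> code x = code' v' by move=> /rootP ->.
have code_root' x : pa' x = None -> code' x = code v by move=> /rootP' ->.
have v0 : pa v = None by apply/rootP.
have v0' : pa' v' = None by apply/rootP'.
have f_inj : injective f := matching_inj rkP children rootI v0' code_root.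
have g_inj := matching_inj rkP' children' rootI' v0 code_root'.
have fP x : pa' (f x) = omap f (pa x).
  by have [] := matchingP rkP children v0' code_root x.
exists f; split; last exact: matching_root.
(* The matching in the opposite direction is injective too, which gives the
   inequality of cardinals needed for bijectivity. *)
split; first by apply: inj_card_bij f_inj _; apply: leq_card g_inj.
move=> x y; rewrite edgeP edgeP' !fP.
have omap_eq a b : (omap f a == Some (f b)) = (a == Some b).
  by rewrite -[Some (f b)]/(omap f (Some b)) (inj_eq (inj_omap f_inj)).
by rewrite !omap_eq.
Qed.
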